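(* Let $p\geqslant n\geqslant1$, $\gamma>0$, $A=(I_n,0,\dots,0)\in\mathcal M_{n,p}(\mathbb R)$, $B,\Sigma\in\mathcal M_{p,p}(\mathbb R)$, and let $U\in\mathcal C^\infty(\mathbb R^n)$ have all its derivatives of order $2$ or more bounded. Assume that there exist $\lambda,\Lambda,\kappa>0$ and a real symmetric positive definite $p\times p$ matrix $N$ such that $$NB\geqslant\kappa N\qquad\text{and}\qquad\lambda I_n\leqslant\nabla^2U(x)\leqslant\Lambda I_n\quad\forall x\in\mathbb R^n.$$ Assume moreover the following. - If $p>n$: writing $B=\begin{pmatrix} B_{11} & B_{12} \\ B_{21} & B_{22} \end{pmatrix}$ with $B_{11},B_{12},B_{21},B_{22}$ of respective sizes $n\times n$, $n\times(p-n)$, $(p-n)\times n$, $(p-n)\times(p-n)$, the matrix $B_{22}$ is invertible and $E:=B_{11}-B_{12}B_{22}^{-1}B_{21}$ is a positive definite symmetric matrix; set $D=B_{12}B_{22}^{-1}$. - If $p=n$: $B$ is symmetric positive definite; set $D=0$ and $E=B$. Let $h_1,\dots,h_5>0$ be constants such that $$NA^TAN\leqslant h_1N,\qquad\frac1{h_2}I_n\leqslant E\leqslant h_3I_n,\qquad\begin{pmatrix}I_n&-D\\0&0\end{pmatrix}\leqslant h_4N,\qquad\begin{pmatrix}I_n&-D\\-D^T&D^TD\end{pmatrix}\leqslant h_5N$$ (in the case $p=n$, the last two conditions read simply $I_n\leqslant h_4N$ and $h_5=h_4$). Set $$\gamma_0=2\sqrt{\frac{h_1\Lambda}\kappa}\,\max\left(\sqrt{h_2h_5},\sqrt{\frac{h_4}\kappa}\right).$$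 If $\gamma\geqslant\gamma_0$, then the drift of the process $$\mathrm dX_t=AY_t\,\mathrm dt,\qquad\mathrm dY_t=-A^T\nabla U(X_t)\,\mathrm dt-\gamma BY_t\,\mathrm dt+\sqrt\gamma\,\Sigma\,\mathrm dW_t$$ on $\mathbb R^n\times\mathbb R^p$ satisfies $\mathrm{Cont}_R(M,\rho)$ with $$\rho=\min\left(\frac\lambda{3h_3\gamma},\frac{\gamma\kappa}6\right),$$ for a (symmetric positive definite, explicit) matrix $M$ such that $$\frac12\begin{pmatrix}E&0\\0&\frac\kappa{\Lambda h_1}N\end{pmatrix}\leqslant M\leqslant\frac32\begin{pmatrix}E&0\\0&\frac\kappa{\Lambda h_1}N\end{pmatrix}.$$
   Context: $\mathcal M_{k,\ell}(\mathbb R)$ is the set of real matrices with $k$ rows and $\ell$ columns; $W$ is a standard Brownian motion of dimension $p$. For real square matrices $A_1,A_2$, not necessarily symmetric, $A_1\leqslant A_2$ means $u\cdot A_1u\leqslant u\cdot A_2u$ for all vectors $u$ (similarly $\geqslant$). The drift of the process is $b(x,y)=(Ay,\,-A^T\nabla U(x)-\gamma By)$ on $\mathbb R^{n+p}$. For a smooth map $b:\mathbb R^d\to\mathbb R^d$ with Jacobian matrix $J_b(z)=(\partial_{z_j}b_i(z))_{1\leqslant i,j\leqslant d}$, a real symmetric positive definite $d\times d$ matrix $M$ and $\rho\in\mathbb R$, the condition $\mathrm{Cont}_R(M,\rho)$ means: $MJ_b(z)\leqslant-\rho M$ for all $z\in\mathbb R^d$. *)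

(* Defs.v *)
From HB Require Import structures.
From mathcomp Require Import all_boot all_order all_algebra.
From mathcomp Require Import all_classical all_reals all_analysis.

Set Implicit Arguments.
Unset Strict Implicit.
Unset Printing Implicit Defensive.

Import Order.TTheory GRing.Theory Num.Theory.
Import numFieldNormedType.Exports.

Local Open Scope ring_scope.

(* Points of R^d are column vectors 'cV[R]_d. *)

Definition quad (R : realType) (d : nat) (A : 'M[R]_d) (u : 'cV[R]_d) : R :=
  (u^T *m (A *m u)) 0 0.

(* The matrices need not be symmetric: only quadratic forms are compared. *)
Definition qle (R : realType) (d : nat) (A1 A2 : 'M[R]_d) : Prop :=
  forall u : 'cV[R]_d, quad A1 u <= quad A2 u.

Notation "A1 <=q A2" := (qle A1 A2) (at level 70, no associativity).

Definition sym_posdef (R : realType) (d : nat) (M : 'M[R]_d) : Prop :=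
  M^T = M /\ forall u : 'cV[R]_d, u != 0 -> 0 < quad M u.

Definition partial (R : realType) (d : nat) (i : 'I_d) (f : 'cV[R]_d -> R)
    (x : 'cV[R]_d) : R :=
  'D_(delta_mx i 0) f x.

(* partials [:: i1; ..; ik] f is the k-th order derivative
   d_{i1} (d_{i2} ( .. (d_{ik} f))). *)
Definition partials (R : realType) (d : nat) (s : seq 'I_d)
    (f : 'cV[R]_d -> R) : 'cV[R]_d -> R :=
  foldr (@partial R d) f s.

(* C^oo: the partial derivatives of every order exist and are continuous. *)
Definition smooth (R : realType) (d : nat) (f : 'cV[R]_d -> R) : Prop :=
  forall s : seq 'I_d,
    continuous (partials s f) /\
    forall (i : 'I_d) (x : 'cV[R]_d),
      derivable (partials s f) x (delta_mx i 0).

Definition bounded_derivatives_from (R : realType) (d k : nat)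
    (f : 'cV[R]_d -> R) : Prop :=
  forall s : seq 'I_d, (k <= size s)%N ->
    exists C : R, forall x : 'cV[R]_d, `|partials s f x| <= C.

Definition grad (R : realType) (d : nat) (f : 'cV[R]_d -> R)
    (x : 'cV[R]_d) : 'cV[R]_d :=
  \col_i partial i f x.

Definition hessian (R : realType) (d : nat) (f : 'cV[R]_d -> R)
    (x : 'cV[R]_d) : 'M[R]_d :=
  \matrix_(i, j) partial i (partial j f) x.

(* Row i, column j is d_{z_j} b_i; the library's 'J, made for row vectors,
   is the transpose of this. *)
Definition jac (R : realType) (d : nat) (b : 'cV[R]_d -> 'cV[R]_d)
    (z : 'cV[R]_d) : 'M[R]_d :=
  \matrix_(i, j) partial j (fun z' => b z' i 0) z.

Definition ContR (R : realType) (d : nat) (b : 'cV[R]_d -> 'cV[R]_d)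
    (M : 'M[R]_d) (rho : R) : Prop :=
  forall z : 'cV[R]_d, M *m jac b z <=q (- rho) *: M.

(* The coefficients of dZ = drift(Z) dt + noise(Z) dW on R^d, with W a
   k-dimensional Brownian motion. *)
Record diffusion (R : realType) (d k : nat) := Diffusion {
  drift : 'cV[R]_d -> 'cV[R]_d;
  noise : 'cV[R]_d -> 'M[R]_(d, k)
}.

(* Throughout, p >= n is written p = n + m, so that p = n is m = 0. *)

Definition Amx (R : realType) (n m : nat) : 'M[R]_(n, n + m) := row_mx 1%:M 0.
Arguments Amx {R n m}.

(* dX = A Y dt,  dY = - A^T grad U(X) dt - gamma B Y dt + sqrt(gamma) Sigma dW,
   where Z = (X, Y) is the column vector X on top of Y. *)
Definition langevin (R : realType) (n m : nat) (U : 'cV[R]_n -> R) (gamma : R)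
    (B Sigma : 'M[R]_(n + m)) : diffusion R (n + (n + m)) (n + m) :=
  {| drift := fun z =>
       let x := usubmx z in
       let y := dsubmx z in
       col_mx (Amx *m y) (- (Amx^T *m grad U x) - gamma *: (B *m y));
     noise := fun _ => col_mx 0 (Num.sqrt gamma *: Sigma) |}.

(* For m = 0 the blocks B12, B21, B22 are empty: Dmx B is the empty (zero)
   matrix, and Emx B is B itself, up to the identification of 'M_(n + 0)
   with 'M_n. *)
Definition Dmx (R : realType) (n m : nat) (B : 'M[R]_(n + m)) : 'M[R]_(n, m) :=
  ursubmx B *m invmx (drsubmx B).

Definition Emx (R : realType) (n m : nat) (B : 'M[R]_(n + m)) : 'M[R]_n :=
  ulsubmx B - ursubmx B *m invmx (drsubmx B) *m dlsubmx B.

(* Main.v *)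
(* Put G = (I, -D). Then G A^T = I, and G B = E A because D B22 = B12, so that
   the slow variable E x + G y / gamma has drift - grad U(x) / gamma. This
   suggests M = [[E, G / gamma], [G^T / gamma, a N]] with a = kappa / (Lambda h1).
   With H the Hessian of U, the quadratic form of M J at (u, v) is
     (v.A^T G v - u.H u) / gamma - a v.N A^T H u - a gamma v.N B v.
   As H is symmetric (Schwarz's theorem) and positive, expanding
   H(u + a gamma A N v) >= 0 bounds the cross term by
   u.H u / (2 gamma) + a gamma kappa v.N v / 2; the condition on gamma absorbs
   the term v.A^T G v, and also makes M comparable to diag(E, a N). *)

Require Import Defs.
From HB Require Import structures.
From mathcomp Require Import all_boot all_order all_algebra.
From mathcomp Require Import all_classical all_reals all_analysis.
From mathcomp Require Import ring lra.

Set Implicit Arguments.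
Unset Strict Implicit.
Unset Printing Implicit Defensive.

Import Order.TTheory GRing.Theory Num.Theory.
Import numFieldNormedType.Exports.

Local Open Scope ring_scope.

(** * Symmetry of mixed second derivatives *)

Section Schwarz.
Context {R : realType} {V : normedModType R}.
Implicit Types (f : V -> R) (x v w : V).
Local Open Scope classical_set_scope.

(** The two difference quotients are the same function of [h]. This makes the one-variable mean
    value theorem applicable along a line. *)
Lemma is_derive_line f x v (t : R) : derivable f (x + t *: v) v ->
  is_derive t 1 (fun s : R => f (x + s *: v)) ('D_v f (x + t *: v)).
Proof.
have E : (fun h : R => h^-1 *: (((fun s : R => f (x + s *: v)) \o shift t) (h *: 1)
            - f (x + t *: v)))
       = (fun h : R => h^-1 *: ((f \o shift (x + t *: v)) (h *: v) - f (x + t *: v))).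
  apply/funext => h /=.
  by rewrite [h *: 1]mulr1 scalerDl addrCA.
by move=> df; split; rewrite /derive ?/derivable E.
Qed.

(* The second difference is symmetric in v and w up to a swap of its middle
   terms, so both mixed derivatives are attained close to x with equal values. *)
Lemma second_difference_mvt f x v w (h : R) : 0 < h ->
  (forall y, derivable f y v) -> (forall y, derivable ('D_v f) y w) ->
  exists a b : R, [/\ 0 <= a <= h, 0 <= b <= h &
    f (x + h *: v + h *: w) - f (x + h *: v) - (f (x + h *: w) - f x)
    = 'D_w ('D_v f) (x + a *: v + b *: w) * h * h].
Proof.
move=> h0 dv dwv.
have h0' : 0 <= h := ltW h0.
(* The mean value theorem is applied along [v] to the increment [g] of [f] in direction [w], and
   then along [w] to ['D_v f]. *)
pose g (s : R) : R := f (x + h *: w + s *: v) - f (x + s *: v).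
pose dg (s : R) : R := 'D_v f (x + h *: w + s *: v) - 'D_v f (x + s *: v).
have gd (s : R) : is_derive s 1 g (dg s).
  by apply: is_deriveB; apply: is_derive_line.
have [a aI ga] := MVT_segment h0' (fun s _ => gd s)
  (derivable_within_continuous (fun s _ => @ex_derive _ _ _ _ _ _ _ (gd s))).
pose k (t : R) : R := 'D_v f (x + a *: v + t *: w).
have kd (t : R) : is_derive t 1 k ('D_w ('D_v f) (x + a *: v + t *: w)).
  exact: is_derive_line.
have [b bI kb] := MVT_segment h0' (fun s _ => kd s)
  (derivable_within_continuous (fun s _ => @ex_derive _ _ _ _ _ _ _ (kd s))).
exists a, b; split; [by rewrite in_itv in aI | by rewrite in_itv in bI |].
move: ga kb; rewrite /g /dg /k !subr0 !scale0r !addr0 (addrAC x) => ->.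
by rewrite (addrAC x (h *: w)) => ->.
Qed.

(** Schwarz's theorem: the mixed derivatives take a common value at two points arbitrarily close to
    [x], and continuity at [x] carries the equality over up to any [e]. *)
Lemma derive_comm f x v w :
  (forall y, derivable f y v) -> (forall y, derivable f y w) ->
  (forall y, derivable ('D_v f) y w) -> (forall y, derivable ('D_w f) y v) ->
  {for x, continuous ('D_w ('D_v f))} -> {for x, continuous ('D_v ('D_w f))} ->
  'D_w ('D_v f) x = 'D_v ('D_w f) x.
Proof.
move=> dv dw dwv dvw cwv cvw.
apply/eqP; rewrite -subr_eq0 -normr_le0; apply/ler_addgt0Pr => e e0; rewrite add0r.
have e20 : 0 < e / 2 by rewrite divr_gt0.
have near_step F : {for x, continuous (F : V -> R)} ->
    exists2 d : R, 0 < d & forall y, `|y - x| < d -> `|F x - F y| < e / 2.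
  move=> /cvgr_dist_lt /(_ _ e20) /nbhs_normP [d /= d0 dF].
  by exists d => // y yx; apply: dF => /=; rewrite distrC.
have [d1 d10 F1] := near_step _ cwv.
have [d2 d20 F2] := near_step _ cvw.
pose d := Num.min d1 d2.
have d0 : 0 < d by rewrite lt_min d10.
have dd1 : d <= d1 by rewrite ge_min lexx.
have dd2 : d <= d2 by rewrite ge_min lexx orbT.
(* Since [h * K = d / 2], moving by at most [h] along [v] and along [w] stays within [d] of [x]. The
   [+ 1] keeps [K] positive when both vectors vanish. *)
pose K := `|v| + `|w| + 1.
have K0 : 0 < K by rewrite ltr_wpDl // addr_ge0.
pose h := d / (2 * K).
have h0 : 0 < h by rewrite divr_gt0 // mulr_gt0.
have close (a b : R) : 0 <= a <= h -> 0 <= b <= h ->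
    `|x + a *: v + b *: w - x| < d.
  move=> /andP[a0 ah] /andP[b0 bh].
  rewrite -(addrA x) (addrC x) addrK (le_lt_trans (ler_normD _ _)) // !normrZ.
  rewrite (ger0_norm a0) (ger0_norm b0).
  apply: (@le_lt_trans _ _ (h * K)).
    rewrite /K mulrDr mulrDr mulr1 -[leLHS]addr0.
    by rewrite !lerD ?ler_wpM2r // ltW.
  rewrite /h invfM mulrA mulfVK ?gt_eqF // ltr_pdivrMr //.
  by rewrite ltr_pMr // ltr1n.
have [a [b [aI bI E1]]] := second_difference_mvt x h0 dv dwv.
have [a' [b' [aI' bI' E2]]] := second_difference_mvt x h0 dw dvw.
have E : 'D_w ('D_v f) (x + a *: v + b *: w)
       = 'D_v ('D_w f) (x + a' *: w + b' *: v).
  apply: (mulIf (lt0r_neq0 h0)); apply: (mulIf (lt0r_neq0 h0)).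
  apply: etrans (esym E1) (etrans _ E2); rewrite (addrAC x (h *: w)).
  by rewrite !opprB addrACA [RHS]addrACA (addrC (- _)).
have L1 : `|'D_w ('D_v f) x - 'D_w ('D_v f) (x + a *: v + b *: w)| < e / 2.
  by apply: F1; apply: lt_le_trans (close _ _ aI bI) dd1.
have := close _ _ bI' aI'; rewrite (addrAC x) => c2.
have L2 : `|'D_v ('D_w f) x - 'D_v ('D_w f) (x + a' *: w + b' *: v)| < e / 2.
  by apply: F2; apply: lt_le_trans c2 dd2.
have tri (r s t t' : R) : t = t' -> `|r - t| < e / 2 -> `|s - t'| < e / 2 ->
    `|r - s| <= e.
  move=> <- rt st; apply: ltW; rewrite (splitr e).
  apply: le_lt_trans (ltrD rt st); rewrite (distrC s).
  exact: ler_distD.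
exact: tri E L1 L2.
Qed.

End Schwarz.

Lemma hessian_sym (R : realType) (n : nat) (U : 'cV[R]_n -> R)
  (x : 'cV[R]_n) : smooth U -> (hessian U x)^T = hessian U x.
Proof.
move=> sU; apply/matrixP => i j; rewrite !mxE; apply: derive_comm.
- by move=> y; have [_] := sU [::]; apply.
- by move=> y; have [_] := sU [::]; apply.
- by move=> y; have [_] := sU [:: i]; apply.
- by move=> y; have [_] := sU [:: j]; apply.
- by have [+ _] := sU [:: j; i]; apply.
- by have [+ _] := sU [:: i; j]; apply.
Qed.

(** * The Jacobian of the drift *)

Lemma is_derive_affine (R : realType) (V : normedModType R) (f : V -> R)
  (x v : V) (c : R) : (forall h : R, f (h *: v + x) = f x + h * c) ->
  is_derive x v f c.
Proof.
move=> fE.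
have cv : ((fun h : R => h^-1 *: ((f \o shift x) (h *: v) - f x)) @ 0^' --> c)%classic.
  apply: cvg_near_cst; near=> h.
  have h0 : h != 0 by near: h; exact: nbhs_dnbhs_neq.
  by rewrite /= fE addrAC subrr add0r scalerA mulVf // scale1r.
split; last exact: cvg_lim cv.
by apply/cvg_ex; exists c.
Unshelve. all: by end_near.
Qed.

(** A linear [l] sends the line through [z] along [v] to the line through [l z] along [l v], so the
    difference quotients coincide. *)
Lemma is_derive_comp_linear (R : realType) (V W : normedModType R)
  (l : V -> W) (g : W -> R) (z v : V) :
  linear l -> derivable g (l z) (l v) -> is_derive z v (g \o l) ('D_(l v) g (l z)).
Proof.
move=> lin_l.
have E : (fun h : R => h^-1 *: (((g \o l) \o shift z) (h *: v) - (g \o l) z))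
       = (fun h : R => h^-1 *: ((g \o shift (l z)) (h *: l v) - g (l z))).
  by apply/funext => h; rewrite /= lin_l.
by move=> dg; split; rewrite /derive ?/derivable E.
Qed.

(** The Hessian comes out transposed because the row index of [hessian] is the outer derivative,
    while the row index of [jac] is the component of the drift. *)
Lemma jac_langevin (R : realType) (n m : nat) (U : 'cV[R]_n -> R)
  (gamma : R) (B Sigma : 'M[R]_(n + m)) (z : 'cV[R]_(n + (n + m))) :
  smooth U ->
  jac (drift (langevin U gamma B Sigma)) z
  = block_mx 0 Amx (- (Amx^T *m (hessian U (usubmx z))^T)) (- (gamma *: B)).
Proof.
move=> sU; apply/matrixP => i j; rewrite mxE /partial.
have dlin k (C : 'M[R]_(k, n + m)) (i' : 'I_k) (v : 'cV[R]_(n + (n + m))) :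
    is_derive z v (fun z' => (C *m dsubmx z') i' 0) ((C *m dsubmx v) i' 0).
  apply: is_derive_affine => h.
  rewrite linearD /= linearZ /= mulmxDr -scalemxAr.
  by rewrite [LHS]mxE addrC [X in _ + X]mxE.
case: (split_ordP i) => i' ->{i}.
  rewrite (_ : (fun z' => _) = (fun z' => (Amx *m dsubmx z') i' 0)); last first.
    by apply/funext => z' /=; rewrite col_mxEu.
  rewrite derive_val.
  case: (split_ordP j) => j' ->{j}.
    rewrite block_mxEul [RHS]mxE mxE big1 // => k _.
    by rewrite !mxE eq_rlshift mulr0.
  rewrite block_mxEur mxE (bigD1 j') //= big1 => [|k kj].
    by rewrite !mxE eqxx mulr1 addr0.
  by rewrite !mxE eq_rshift (negbTE kj) mulr0.
pose f := fun z' : 'cV[R]_(n + (n + m)) =>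
  - (\sum_k Amx^T i' k * (partial k U \o usubmx) z') - gamma * (B *m dsubmx z') i' 0.
rewrite (_ : (fun z' => _) = f); last first.
  apply/funext => z'; rewrite /f /= col_mxEd !mxE; congr (- _ - _).
  by apply: eq_bigr => k _; rewrite !mxE.
pose v : 'cV[R]_(n + (n + m)) := delta_mx j 0.
pose dU k := 'D_(usubmx v) (partial k U) (usubmx z).
have dUP k : is_derive z v (partial k U \o usubmx) (dU k).
  apply: is_derive_comp_linear; first exact: linearP.
  rewrite /v.
  (* A direction in the [x] block projects to a basis vector, where smoothness applies; one in the
     [y] block projects to 0, along which everything is derivable. *)
  case: (split_ordP j) => j' ->.
    rewrite (_ : usubmx (delta_mx _ _) = delta_mx j' 0).
      by have [_] := sU [:: k]; exact.
    by apply/matrixP => a b; rewrite !mxE eq_lshift.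
  rewrite (_ : usubmx (delta_mx _ _) = 0); first exact: derivable0.
  by apply/matrixP => a b; rewrite !mxE eq_lrshift.
have fP : is_derive z v f
    (- (\sum_k Amx^T i' k * dU k) - gamma * (B *m dsubmx v) i' 0).
  have sumP : is_derive z v (fun z' => \sum_k Amx^T i' k * (partial k U \o usubmx) z')
      (\sum_k Amx^T i' k * dU k).
    have := is_derive_sum (fun k => is_deriveZ (Amx^T i' k) (dUP k)).
    by rewrite fct_sumE.
  exact: (is_deriveB (is_deriveN sumP) (is_deriveZ gamma (dlin _ B i' v))).
rewrite derive_val /dU /v.
case: (split_ordP j) => j' ->{j v dU dUP fP}.
  rewrite block_mxEdl (_ : usubmx (delta_mx _ _) = delta_mx j' 0); last first.
    by apply/matrixP => a b; rewrite !mxE eq_lshift.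
  rewrite (_ : dsubmx (delta_mx _ _) = 0); last first.
    by apply/matrixP => a b; rewrite !mxE eq_rlshift.
  rewrite mulmx0 !mxE mulr0 subr0; congr (- _).
  by apply: eq_bigr => k _; rewrite !mxE.
rewrite block_mxEdr (_ : usubmx (delta_mx _ _) = 0); last first.
  by apply/matrixP => a b; rewrite !mxE eq_lrshift.
rewrite (_ : dsubmx (delta_mx _ _) = delta_mx j' 0); last first.
  by apply/matrixP => a b; rewrite !mxE eq_rshift.
rewrite big1 => [|k _]; last by rewrite derive0 mulr0.
by rewrite oppr0 add0r -colE !mxE.
Qed.

(** * Scalar products and quadratic forms *)

Section Dot.
Context {R : realType}.

Definition dot (d : nat) (u v : 'cV[R]_d) : R := (u^T *m v) 0 0.

Lemma dotC d (u v : 'cV[R]_d) : dot u v = dot v u.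
Proof. by rewrite /dot -(trmxK (u^T *m v)) trmx_mul trmxK mxE. Qed.

Lemma dotDr d (u v w : 'cV[R]_d) : dot u (v + w) = dot u v + dot u w.
Proof. by rewrite /dot mulmxDr mxE. Qed.

Lemma dotZr d (u v : 'cV[R]_d) (c : R) : dot u (c *: v) = c * dot u v.
Proof. by rewrite /dot -scalemxAr mxE. Qed.

Lemma dotNr d (u v : 'cV[R]_d) : dot u (- v) = - dot u v.
Proof. by rewrite /dot mulmxN mxE. Qed.

Lemma dotDl d (u v w : 'cV[R]_d) : dot (v + w) u = dot v u + dot w u.
Proof. by rewrite dotC dotDr !(dotC u). Qed.

Lemma dotZl d (u v : 'cV[R]_d) (c : R) : dot (c *: v) u = c * dot v u.
Proof. by rewrite dotC dotZr (dotC u). Qed.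

Lemma dot_mulmx d k (A : 'M[R]_(d, k)) (u : 'cV[R]_d) (v : 'cV[R]_k) :
  dot u (A *m v) = dot (A^T *m u) v.
Proof. by rewrite /dot trmx_mul trmxK mulmxA. Qed.

Lemma dot_col_mx d k (u u' : 'cV[R]_d) (v v' : 'cV[R]_k) :
  dot (col_mx u v) (col_mx u' v') = dot u u' + dot v v'.
Proof. by rewrite /dot tr_col_mx mul_row_col mxE. Qed.

Lemma dot_ge0 d (u : 'cV[R]_d) : 0 <= dot u u.
Proof. by rewrite /dot mxE sumr_ge0 // => i _; rewrite mxE -expr2 sqr_ge0. Qed.

Lemma dot_gt0 d (u : 'cV[R]_d) : u != 0 -> 0 < dot u u.
Proof.
move=> u0; rewrite lt_neqAle dot_ge0 andbT eq_sym; apply: contra u0 => /eqP.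
rewrite /dot mxE => /psumr_eq0P e0.
apply/eqP/colP => i; rewrite mxE; apply/eqP; rewrite -sqrf_eq0 expr2.
by have /(_ _ i isT) := e0; rewrite mxE => -> // j _; rewrite mxE -expr2 sqr_ge0.
Qed.

Lemma quadE d (A : 'M[R]_d) u : quad A u = dot u (A *m u).
Proof. by []. Qed.

Lemma quadZ d (A : 'M[R]_d) (c : R) u : quad (c *: A) u = c * quad A u.
Proof. by rewrite !quadE -scalemxAl dotZr. Qed.

Lemma quad_scalar d (c : R) (u : 'cV[R]_d) : quad (c *: 1%:M) u = c * dot u u.
Proof. by rewrite quadZ quadE mul1mx. Qed.

Lemma quad_gram d k (G : 'M[R]_(k, d)) u :
  quad (G^T *m G) u = dot (G *m u) (G *m u).
Proof. by rewrite quadE -mulmxA dot_mulmx trmxK. Qed.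

End Dot.

(** * Algebra of the twisted metric *)

Section TwistedMetric.
Context {R : realType} {n m : nat}.
Implicit Types (B N : 'M[R]_(n + m)) (H : 'M[R]_n) (u : 'cV[R]_n)
  (v : 'cV[R]_(n + m)).

Definition Gmx B : 'M[R]_(n, n + m) := row_mx 1%:M (- Dmx B).

Definition Mmx (a gamma : R) B N : 'M[R]_(n + (n + m)) :=
  block_mx (Emx B) (gamma^-1 *: Gmx B) (gamma^-1 *: (Gmx B)^T) (a *: N).

(** The second block [B12 - D B22] vanishes. What remains lets the friction term cancel [E A v] in
    the first block row of [M J]. *)
Lemma Gmx_mulB B : drsubmx B \in unitmx -> Gmx B *m B = Emx B *m Amx.
Proof.
move=> uB; rewrite /Gmx /Amx -[X in _ *m X = _](submxK B) mul_row_block mul_mx_row.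
rewrite mulmx1 mulmx0 !mul1mx !mulNmx /Dmx.
by rewrite mulmxKV // subrr.
Qed.

Lemma Gmx_trA B : Gmx B *m (@Amx R n m)^T = 1%:M.
Proof. by rewrite /Gmx /Amx tr_row_mx mul_row_col trmx1 mulmx1 trmx0 mulmx0 addr0. Qed.

(** Identifies the matrix of the [h4] condition, which controls the term [v.A^T G v]. *)
Lemma trA_Gmx B : (@Amx R n m)^T *m Gmx B = block_mx 1%:M (- Dmx B) 0 0.
Proof.
by rewrite /Gmx /Amx tr_row_mx mul_col_row trmx1 trmx0 !mul1mx !mul0mx.
Qed.

(** The matrix of the [h5] condition is a Gram matrix, so that condition reads
    [|G v|^2 <= h5 v.N v]. *)
Lemma trG_Gmx B : (Gmx B)^T *m Gmx B =
  block_mx 1%:M (- Dmx B) (- (Dmx B)^T) ((Dmx B)^T *m Dmx B).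
Proof.
rewrite /Gmx tr_row_mx mul_col_row trmx1 !mul1mx mulmx1 linearN /=.
by rewrite mulmxN mulNmx opprK.
Qed.

Lemma quad_diag B N (a : R) u v :
  quad (block_mx (Emx B) 0 0 (a *: N)) (col_mx u v)
  = quad (Emx B) u + a * quad N v.
Proof.
by rewrite quadE mul_block_col !mul0mx addr0 add0r dot_col_mx -quadE -quadE quadZ.
Qed.

Lemma Mmx_mul_col (a gamma : R) B N u v : Mmx a gamma B N *m col_mx u v =
  col_mx (Emx B *m u + gamma^-1 *: (Gmx B *m v))
         (gamma^-1 *: ((Gmx B)^T *m u) + a *: (N *m v)).
Proof. by rewrite mul_block_col -!scalemxAl. Qed.

Lemma quad_Mmx (a gamma : R) B N u v :
  quad (Mmx a gamma B N) (col_mx u v)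
  = quad (Emx B) u + 2 / gamma * dot u (Gmx B *m v) + a * quad N v.
Proof.
rewrite quadE Mmx_mul_col dot_col_mx !dotDr !dotZr.
rewrite [dot v (_^T *m u)]dot_mulmx trmxK (dotC _ u).
by rewrite !quadE; ring.
Qed.

(** In the first block row, [E A v] cancels against [G B v] ([e2]) and [G A^T = I] ([e1]) leaves
    only [- H u / gamma]. The sole term mixing [u] and [v] thus comes from the second block row. *)
Lemma quad_Mmx_drift (a gamma : R) B N H u v :
  gamma != 0 -> drsubmx B \in unitmx ->
  quad (Mmx a gamma B N *m block_mx 0 Amx (- (Amx^T *m H)) (- (gamma *: B)))
       (col_mx u v)
  = gamma^-1 * quad (Amx^T *m Gmx B) v - gamma^-1 * quad H u
    - a * dot v (N *m Amx^T *m (H *m u)) - a * gamma * quad (N *m B) v.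
Proof.
move=> g0 uB; have e1 : Gmx B *m (Amx^T *m H *m u) = H *m u.
  by rewrite 2!mulmxA Gmx_trA mul1mx.
have e2 : Gmx B *m (B *m v) = Emx B *m (Amx *m v).
  by rewrite !mulmxA Gmx_mulB.
(* A quadratic form is unchanged when its matrix is transposed. *)
have e3 : dot v ((Gmx B)^T *m (Amx *m v)) = quad (Amx^T *m Gmx B) v.
  by rewrite dot_mulmx trmxK dotC quadE -mulmxA [RHS]dot_mulmx trmxK.
rewrite quadE -mulmxA mul_block_col mul0mx add0r Mmx_mul_col dot_col_mx.
rewrite !mulNmx -scalemxAl !mulmxDr !mulmxN -!scalemxAr e1 e2.
rewrite !dotDr !dotZr !dotDr !dotNr !dotZr e3 !quadE !mulmxA.
by field.
Qed.

(** Expand [quad H (u + t *: w) >= 0]; the symmetry of [H] merges the two cross terms. *)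
Lemma psd_cross H (u w : 'cV[R]_n) (t : R) :
  H^T = H -> (forall x, 0 <= quad H x) ->
  - (2 * t * dot w (H *m u)) <= quad H u + t ^+ 2 * quad H w.
Proof.
move=> sH pH; have := pH (u + t *: w).
rewrite quadE mulmxDr -scalemxAr !dotDr !dotDl !dotZr !dotZl -!quadE.
rewrite [dot u (H *m w)]dot_mulmx sH (dotC _ w) => h.
by rewrite -subr_ge0; move: h; congr (_ <= _); ring.
Qed.

End TwistedMetric.

(** * Estimates under the lower bound on [gamma] *)

Lemma sqr_bound_of_sqrt (R : realType) (c x g : R) : 0 <= c -> 0 <= x ->
  2 * Num.sqrt c * Num.sqrt x <= g -> 4 * (c * x) <= g ^+ 2.
Proof.
move=> c0 x0 h.
have -> : 4 * (c * x) = (2 * Num.sqrt c * Num.sqrt x) ^+ 2.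
  by rewrite !exprMn !sqr_sqrtr //; ring.
by rewrite ler_sqr ?nnegrE // (le_trans _ h) ?mulr_ge0 ?sqrtr_ge0.
Qed.

Section Bounds.
Context {R : realType} {n m : nat}.
Variables (gamma a : R) (B N : 'M[R]_(n + m)).
Hypotheses (gamma_gt0 : 0 < gamma) (a_gt0 : 0 < a) (sN : sym_posdef N).
Implicit Types (u : 'cV[R]_n) (v : 'cV[R]_(n + m)).

Lemma quad_sym_posdef_ge0 v : 0 <= quad N v.
Proof.
have [->|v0] := eqVneq v 0; first by rewrite /quad trmx0 mul0mx mxE.
by rewrite ltW // (proj2 sN).
Qed.

(** Young's inequality between [u] and [G v], with [|u|^2 <= h2 u.E u] and [|G v|^2 <= h5 v.N v].
    The factor one half here yields the factors 1/2 and 3/2 in the comparison of [M] with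
    [diag(E, a N)]. *)
Lemma cross_term_bound (h2 h5 : R) u v : 0 < h2 -> 0 < h5 ->
  h2^-1 *: 1%:M <=q Emx B ->
  block_mx 1%:M (- Dmx B) (- (Dmx B)^T) ((Dmx B)^T *m Dmx B) <=q h5 *: N ->
  4 * (h2 * h5) <= a * gamma ^+ 2 ->
  `|2 / gamma * dot u (Gmx B *m v)| <= (quad (Emx B) u + a * quad N v) / 2.
Proof.
move=> h20 h50 /(_ u) hE /(_ v) hG hg.
move: hE; rewrite quad_scalar mulrC ler_pdivrMr // => hE.
move: hG; rewrite -trG_Gmx quad_gram quadZ => hG.
have Q0 := quad_sym_posdef_ge0 v.
(* Expand |u + t G v|^2 >= 0 at t = +- 2 h2 / gamma. *)
have key (t : R) : t ^+ 2 = (2 * h2 / gamma) ^+ 2 ->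
    - (2 * t * dot u (Gmx B *m v)) <= h2 * (quad (Emx B) u + a * quad N v).
  move=> tE; have := dot_ge0 (u + t *: (Gmx B *m v)).
  rewrite !dotDl !dotDr !dotZl !dotZr (dotC (Gmx B *m v) u) => sq.
  (* This is where the condition [4 h2 h5 <= a gamma^2] enters. *)
  have : t ^+ 2 * dot (Gmx B *m v) (Gmx B *m v) <= h2 * (a * quad N v).
    apply: le_trans (ler_wpM2l (sqr_ge0 t) hG) _.
    have -> : t ^+ 2 * (h5 * quad N v)
            = h2 / gamma ^+ 2 * quad N v * (4 * (h2 * h5)).
      by rewrite tE; field; rewrite gt_eqF.
    have -> : h2 * (a * quad N v)
            = h2 / gamma ^+ 2 * quad N v * (a * gamma ^+ 2).
      by field; rewrite gt_eqF.
    by rewrite ler_wpM2l // mulr_ge0 // divr_ge0 ?exprn_ge0 // ltW.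
  by move: sq hE; rewrite expr2; nra.
have k1 := key _ erefl.
have k2 := key (- (2 * h2 / gamma)) (sqrrN _).
rewrite ler_norml -(ler_pM2l (_ : 0 < 2 * h2)) ?mulr_gt0 //.
rewrite -[X in _ && X](ler_pM2l (_ : 0 < 2 * h2)) ?mulr_gt0 //.
by apply/andP; split; lra.
Qed.

(** Apply [psd_cross] with [w = A N v], then bound [w.H w] by [Lambda |w|^2], and
    [|w|^2 = v.N A^T A N v] by [h1 v.N v]. *)
Lemma hessian_cross_bound (H : 'M[R]_n) (Lambda h1 t : R) u v :
  H^T = H -> 0 <= Lambda -> (forall x, 0 <= quad H x) ->
  H <=q Lambda *: 1%:M -> N *m Amx^T *m Amx *m N <=q h1 *: N ->
  - (2 * t * dot v (N *m Amx^T *m (H *m u)))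
    <= quad H u + t ^+ 2 * (Lambda * (h1 * quad N v)).
Proof.
move=> sH L0 pH HL /(_ v); rewrite quadZ => hN.
pose w := Amx *m (N *m v) : 'cV[R]_n.
have -> : dot v (N *m Amx^T *m (H *m u)) = dot w (H *m u).
  by rewrite dot_mulmx trmx_mul trmxK (proj1 sN) -mulmxA.
apply: le_trans (psd_cross _ _ _ sH pH) _; rewrite lerD2l.
apply: ler_wpM2l; first exact: sqr_ge0.
apply: le_trans (HL w) _; rewrite quad_scalar ler_wpM2l //.
apply: le_trans _ hN.
by rewrite quadE -!mulmxA dot_mulmx (proj1 sN) dot_mulmx trmxK lexx.
Qed.

(** The cross term is split with [t = a gamma]. As [a Lambda h1 = kappa], it costs half of
    [u.H u / gamma] and half of the friction [a gamma kappa v.N v]. The [h4] condition charges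
    another quarter of the friction for [v.A^T G v], leaving a half and a quarter. *)
Lemma contraction_bound (H : 'M[R]_n) (lambda Lambda kappa h1 h3 h4 : R) u v :
  H^T = H -> 0 < lambda -> 0 < Lambda -> 0 < kappa -> 0 < h1 -> 0 < h3 ->
  a * (Lambda * h1) = kappa -> drsubmx B \in unitmx ->
  lambda *: 1%:M <=q H -> H <=q Lambda *: 1%:M ->
  kappa *: N <=q N *m B -> N *m Amx^T *m Amx *m N <=q h1 *: N ->
  Emx B <=q h3 *: 1%:M -> block_mx 1%:M (- Dmx B) 0 0 <=q h4 *: N ->
  4 * h4 <= a * kappa * gamma ^+ 2 ->
  quad (Mmx a gamma B N *m block_mx 0 Amx (- (Amx^T *m H)) (- (gamma *: B)))
       (col_mx u v)
    <= - (lambda / (2 * h3 * gamma) * quad (Emx B) u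
          + gamma * kappa / 4 * (a * quad N v)).
Proof.
move=> sH l0 L0 k0 h10 h30 aE uB lH HL /(_ v) hNB hN /(_ u) hE /(_ v) hA hg.
have pH x : 0 <= quad H x.
  by apply: le_trans (lH x); rewrite quad_scalar mulr_ge0 ?dot_ge0 // ltW.
rewrite quad_Mmx_drift // ?gt_eqF //.
have := hessian_cross_bound (a * gamma) u v sH (ltW L0) pH HL hN.
have -> : (a * gamma) ^+ 2 * (Lambda * (h1 * quad N v))
        = gamma ^+ 2 * kappa * (a * quad N v) by rewrite -aE; ring.
move: {lH}(lH u) hNB hE hA; rewrite -trA_Gmx !quad_scalar !quadZ.
have := quad_sym_posdef_ge0 v.
move: (quad H u) (quad N v) (quad (N *m B) v) (quad (Emx B) u) (dot u u)
  (quad (Amx^T *m Gmx B) v) (dot v _) => q Q b e d s x Q0 lq kb ed sQ hx.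
rewrite -(ler_pM2l gamma_gt0).
have -> : gamma * (gamma^-1 * s - gamma^-1 * q - a * x - a * gamma * b)
        = s - q - a * gamma * x - a * gamma ^+ 2 * b.
  by field; rewrite gt_eqF.
have -> : gamma * - (lambda / (2 * h3 * gamma) * e + gamma * kappa / 4 * (a * Q))
        = - (lambda / 2 * (e / h3) + gamma ^+ 2 * kappa * a * Q / 4).
  by field; rewrite !gt_eqF.
(* The bound [E <= h3] converts the convexity [u.H u >= lambda |u|^2] into decay of [u.E u]. *)
have ed' : lambda * (e / h3) <= lambda * d.
  by rewrite ler_pM2l // ler_pdivrMr // mulrC.
have hQ : 4 * s <= a * kappa * gamma ^+ 2 * Q.
  by apply: le_trans (ler_wpM2r Q0 hg); rewrite -mulrA ler_pM2l.
have hb : a * gamma ^+ 2 * (kappa * Q) <= a * gamma ^+ 2 * b.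
  by rewrite ler_pM2l // mulr_gt0 // exprn_gt0.
lra.
Qed.

End Bounds.

(** * Choice of the weight [a] and assembly of the estimates *)

Theorem theorem9 (R : realType) (n m : nat) (hn : (1 <= n)%N)
  (gamma : R) (hgamma : 0 < gamma)
  (B Sigma : 'M[R]_(n + m))
  (U : 'cV[R]_n -> R) (hU : smooth U) (hUb : bounded_derivatives_from 2 U)
  (lambda Lambda kappa : R)
  (hlambda : 0 < lambda) (hLambda : 0 < Lambda) (hkappa : 0 < kappa)
  (N : 'M[R]_(n + m)) (hN : sym_posdef N)
  (hNB : kappa *: N <=q N *m B)
  (hHess : forall x : 'cV[R]_n,
     lambda *: 1%:M <=q hessian U x /\ hessian U x <=q Lambda *: 1%:M)
  (hB_gt : (0 < m)%N -> drsubmx B \in unitmx /\ sym_posdef (Emx B))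
  (hB_eq : m = 0%N -> sym_posdef B)
  (h1 h2 h3 h4 h5 : R)
  (h1_gt0 : 0 < h1) (h2_gt0 : 0 < h2) (h3_gt0 : 0 < h3)
  (h4_gt0 : 0 < h4) (h5_gt0 : 0 < h5)
  (hh1 : N *m Amx^T *m Amx *m N <=q h1 *: N)
  (hh2 : h2^-1 *: 1%:M <=q Emx B)
  (hh3 : Emx B <=q h3 *: 1%:M)
  (hh4 : block_mx 1%:M (- Dmx B) 0 0 <=q h4 *: N)
  (hh5 : block_mx 1%:M (- Dmx B) (- (Dmx B)^T) ((Dmx B)^T *m Dmx B)
           <=q h5 *: N)
  (hh45 : m = 0%N -> h5 = h4)
  (hgamma0 : 2 * Num.sqrt (h1 * Lambda / kappa)
               * Num.max (Num.sqrt (h2 * h5)) (Num.sqrt (h4 / kappa))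
             <= gamma) :
  exists M : 'M[R]_(n + (n + m)),
    [/\ sym_posdef M,
        2^-1 *: block_mx (Emx B) 0 0 ((kappa / (Lambda * h1)) *: N) <=q M,
        M <=q (3 / 2) *: block_mx (Emx B) 0 0 ((kappa / (Lambda * h1)) *: N) &
        ContR (drift (langevin U gamma B Sigma)) M
          (Num.min (lambda / (3 * h3 * gamma)) (gamma * kappa / 6))].
Proof.
(* Makes the cases [p > n] and [p = n] uniform: for [m = 0] the block [B22] is empty with
   determinant 1, hence invertible, and [E] is a block of the symmetric [B]. *)
have [uB sE] : drsubmx B \in unitmx /\ (Emx B)^T = Emx B.
  case: (posnP m) => [m0|/hB_gt[? []]] //.
  have [sB _] := hB_eq m0; move: B sB {hB_gt hB_eq hNB hh2 hh3 hh4 hh5}; clear -m0.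
  subst m => B sB; split; first by rewrite unitmxE det_mx00 unitr1.
  by rewrite /Emx [ursubmx B]thinmx0 !mul0mx subr0 trmx_ulsub sB.
set a := kappa / (Lambda * h1).
have a0 : 0 < a by rewrite divr_gt0 // mulr_gt0.
have aE : a * (Lambda * h1) = kappa by rewrite divfK // gt_eqF // mulr_gt0.
have c0 : 0 <= h1 * Lambda / kappa by rewrite ltW // divr_gt0 // mulr_gt0.
(* The prefactor of the threshold is therefore [2 / sqrt a]. Squaring the bound on [gamma] for each
   branch of the maximum gives [g25] and [g4]. *)
have cE : h1 * Lambda / kappa = a^-1 by rewrite /a invf_div [h1 * _]mulrC.
have g25 : 4 * (h2 * h5) <= a * gamma ^+ 2.
  have -> : 4 * (h2 * h5) = a * (4 * (h1 * Lambda / kappa * (h2 * h5))).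
    by rewrite cE; field; rewrite gt_eqF.
  rewrite ler_pM2l //; apply: sqr_bound_of_sqrt => //; first by rewrite mulr_ge0 // ltW.
  by apply: le_trans hgamma0; rewrite ler_wpM2l ?mulr_ge0 ?sqrtr_ge0 // le_max lexx.
have g4 : 4 * h4 <= a * kappa * gamma ^+ 2.
  have -> : 4 * h4 = a * kappa * (4 * (h1 * Lambda / kappa * (h4 / kappa))).
    by rewrite cE; field; rewrite !gt_eqF.
  rewrite (ler_pM2l (mulr_gt0 a0 hkappa)).
  apply: sqr_bound_of_sqrt => //; first by rewrite divr_ge0 // ltW.
  apply: le_trans hgamma0; rewrite ler_wpM2l ?mulr_ge0 ?sqrtr_ge0 //.
  by rewrite le_max lexx orbT.
have Q0 := quad_sym_posdef_ge0 hN.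
have E0 u : h2^-1 * dot u u <= quad (Emx B) u.
  by have := hh2 u; rewrite quad_scalar.
have cross u v := cross_term_bound hgamma hN u v h2_gt0 h5_gt0 hh2 hh5 g25.
have lo : 2^-1 *: block_mx (Emx B) 0 0 (a *: N) <=q Mmx a gamma B N.
  move=> z; rewrite -[z]vsubmxK quadZ quad_diag quad_Mmx.
  by have := cross (usubmx z) (dsubmx z); rewrite ler_norml => /andP[]; lra.
have hi : Mmx a gamma B N <=q (3 / 2) *: block_mx (Emx B) 0 0 (a *: N).
  move=> z; rewrite -[z]vsubmxK quadZ quad_diag quad_Mmx.
  by have := cross (usubmx z) (dsubmx z); rewrite ler_norml => /andP[]; lra.
exists (Mmx a gamma B N); split => //.
  split.
    rewrite /Mmx tr_block_mx sE !linearZ /= trmxK.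
    by rewrite (proj1 hN).
  (* By [lo] it suffices that [diag(E, a N)] is positive at [z]: through [E >= 1 / h2] if the upper
     part is nonzero, through [N] otherwise. *)
  move=> z z0; apply: lt_le_trans (lo z).
  rewrite -[z]vsubmxK quadZ quad_diag mulr_gt0 ?invr_gt0 //.
  have [u0|u0] := eqVneq (usubmx z) 0.
    rewrite ltr_wpDl //.
      by apply: le_trans (E0 _); rewrite mulr_ge0 ?dot_ge0 ?invr_ge0 ?ltW.
    apply: (mulr_gt0 a0); apply: (proj2 hN); apply: contra_neq z0 => v0.
    by rewrite -[z]vsubmxK u0 v0 col_mx0.
  apply: ltr_pwDl; last exact: mulr_ge0 (ltW a0) (Q0 _).
  by apply: lt_le_trans (E0 _); rewrite mulr_gt0 ?invr_gt0 ?dot_gt0.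
move=> z w; have [lH HL] := hHess (usubmx z).
rewrite jac_langevin // hessian_sym // -[w]vsubmxK.
have := contraction_bound hgamma a0 hN (usubmx w) (dsubmx w)
  (hessian_sym _ hU) hlambda hLambda hkappa h1_gt0 h3_gt0 aE uB lH HL hNB
  hh1 hh3 hh4 g4.
(* It remains to bound [rho] times the form of [M]. As [rho >= 0], the bound [hi] costs a factor
   3/2, which turns the constants 1/2 and 1/4 of [contraction_bound] into the 1/3 and 1/6 of
   [rho]. *)
move/le_trans; apply; rewrite quadZ mulNr lerN2.
have := hi w; rewrite -{1 2}[w]vsubmxK quadZ quad_diag.
set rho := Num.min _ _ => hM.
have r1 : rho <= lambda / (3 * h3 * gamma) by rewrite ge_min lexx.
have r2 : rho <= gamma * kappa / 6 by rewrite ge_min lexx orbT.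
have r0 : 0 <= rho.
  by rewrite le_min !divr_ge0 ?mulr_ge0 // ltW.
apply: le_trans (ler_wpM2l r0 hM) _.
have e0 : 0 <= quad (Emx B) (usubmx w).
  by apply: le_trans (E0 _); rewrite mulr_ge0 ?dot_ge0 ?invr_ge0 ?ltW.
have q0 : 0 <= a * quad N (dsubmx w) := mulr_ge0 (ltW a0) (Q0 _).
have -> : lambda / (2 * h3 * gamma) = 3 / 2 * (lambda / (3 * h3 * gamma)).
  by field; rewrite !gt_eqF.
have := ler_wpM2r e0 r1; have := ler_wpM2r q0 r2; lra.
Qed.
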